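(* Let $d\ge0$ and $l\ge1$ be integers, $\alpha_1,\dots,\alpha_d\in\mathbb{C}$, $i\in\{0,\dots,l-1\}$, and assume that none of the entries of the list $\hat S(i)$ is a non-positive integer. For $m\ge0$ let $$Q_{ml+i}(x)=x^i\;{}_1F_{ld+l-1}\left[\begin{matrix}-m\\ \hat S(i)\end{matrix};-x^l\right].$$ Then the function $$G_i(x,t)=\frac{(tx)^i}{1-t^l}\;{}_1F_{ld+l-1}\left[\begin{matrix}1\\ \hat S(i)\end{matrix};\frac{(xt)^l}{1-t^l}\right]$$ generates the polynomials $Q_{ml+i}(x)$, $m=0,1,\dots$, in the following way (an identity of power series in $t$): $$G_i(x,t)=\sum_{m=0}^{\infty}t^{ml+i}\,Q_{ml+i}(x).$$
   Context: Put $\alpha_{d+1}=0$ and, for $i\in\{0,\dots,l-1\}$, $1\le k\le d+1$, $0\le r\le l-1$, put $S_{k,r}(i)=\frac{\alpha_k+i-r}{l}+1$. Note $S_{d+1,i}(i)=1$. Let $\hat S(i)$ be the list (with multiplicity) of the $ld+l-1$ numbers $S_{k,r}(i)$ over all pairs $(k,r)$ with $1\le k\le d+1$, $0\le r\le l-1$, except $(k,r)=(d+1,i)$. Pochhammer symbol: $(a)_0=1$, $(a)_j=a(a+1)\cdots(a+j-1)$. Generalized hypergeometric series: ${}_pF_q\left[\begin{matrix}a_1,\dots,a_p\\ b_1,\dots,b_q\end{matrix};z\right]=\sum_{j\ge0}\frac{(a_1)_j\cdots(a_p)_j}{(b_1)_j\cdots(b_q)_j}\frac{z^j}{j!}$.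 (The polynomials $Q_n$ are, up to multiplicative constants, the polynomials $e^{G^l}x^n$ with $G=\rho\prod_{j=1}^d(x\partial_x+\alpha_j+1)\partial_x$ normalized so that $l^{d+1}\rho=1$.) *)

(* Defs.v *)
From HB Require Import structures.
From mathcomp Require Import all_boot all_order all_algebra.
From mathcomp Require Import all_classical all_reals all_analysis.
From mathcomp Require Import complex.

Set Implicit Arguments.
Unset Strict Implicit.
Unset Printing Implicit Defensive.

Import Order.TTheory GRing.Theory Num.Theory.
Import numFieldNormedType.Exports.

Local Open Scope classical_set_scope.
Local Open Scope ring_scope.

(* As a numClosedFieldType, R[i] inherits the topology given by its modulus. *)
Definition Cplx (R : realType) : numClosedFieldType := R[i].

Record fps (A : Type) := Fps { fps_coef :> nat -> A }.

HB.instance Definition _ (A : Type) := gen_eqMixin (fps A).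
HB.instance Definition _ (A : Type) := gen_choiceMixin (fps A).

Section FpsRing.
Variable A : comNzRingType.
Implicit Types f g h : fps A.

Lemma fpsP f g : (forall n, f n = g n) -> f = g.
Proof. by case: f g => [f] [g] /= fg; congr Fps; apply/funext. Qed.

Definition fps_const (a : A) : fps A := Fps (fun n => if n == 0%N then a else 0).
Definition fps_var : fps A := Fps (fun n => (n == 1%N)%:R).
Definition fps_add f g : fps A := Fps (fun n => f n + g n).
Definition fps_opp f : fps A := Fps (fun n => - f n).
Definition fps_mul f g : fps A :=
  Fps (fun n => \sum_(k < n.+1) f k * g (n - k)%N).

Let addA : associative fps_add.
Proof. by move=> f g h; apply: fpsP => n /=; rewrite addrA. Qed.
Let addC : commutative fps_add.
Proof. by move=> f g; apply: fpsP => n /=; rewrite addrC. Qed.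
Let add0 : left_id (fps_const 0) fps_add.
Proof. by move=> f; apply: fpsP => n /=; case: ifP; rewrite add0r. Qed.
Let addN : left_inverse (fps_const 0) fps_opp fps_add.
Proof. by move=> f; apply: fpsP => n /=; rewrite addNr if_same. Qed.

HB.instance Definition _ := GRing.isZmodule.Build (fps A) addA addC add0 addN.

(* Truncating at order n is a ring morphism to polynomials modulo 'X^n.+1;
   the ring axioms are transported from {poly A}. *)
Let trunc n f : {poly A} := \poly_(k < n.+1) f k.

Let coef_trunc n f k : (k <= n)%N -> (trunc n f)`_k = f k.
Proof. by move=> kn; rewrite coef_poly ltnS kn. Qed.

Let coef_truncM n f g k : (k <= n)%N ->
  (trunc n f * trunc n g)`_k = fps_mul f g k.
Proof.
move=> kn; rewrite coefM /=; apply: eq_bigr => j _.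
have jk : (j <= k)%N by rewrite -ltnS.
by rewrite !coef_trunc ?(leq_trans jk) ?(leq_trans (leq_subr _ _)).
Qed.

Let mulC : commutative fps_mul.
Proof.
by move=> f g; apply: fpsP => n; rewrite -!(@coef_truncM n) // mulrC.
Qed.

Let mulA : associative fps_mul.
Proof.
move=> f g h; apply: fpsP => n.
transitivity ((trunc n f * (trunc n g * trunc n h))`_n).
  rewrite coefM /=; apply: eq_bigr => j _; rewrite coef_trunc -1?ltnS //.
  by rewrite coef_truncM ?leq_subr.
rewrite mulrA coefM /=; apply: eq_bigr => j _.
by rewrite coef_truncM -1?ltnS // coef_trunc ?leq_subr.
Qed.

Let mul1 : left_id (fps_const 1) fps_mul.
Proof.
move=> f; apply: fpsP => n /=; rewrite big_ord_recl /= mul1r subn0.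
by rewrite big1 ?addr0 // => j _; rewrite mul0r.
Qed.

Let mulD : left_distributive fps_mul fps_add.
Proof.
move=> f g h; apply: fpsP => n /=; rewrite -big_split /=.
by apply: eq_bigr => j _; rewrite mulrDl.
Qed.

Let oner_neq0 : fps_const 1 != fps_const 0.
Proof.
by apply/eqP => /(congr1 (fun f : fps A => f 0%N)) /eqP; rewrite oner_eq0.
Qed.

HB.instance Definition _ :=
  GRing.Zmodule_isComNzRing.Build (fps A) mulA mulC mul1 mulD oner_neq0.

Definition fps_unit : {pred fps A} := fun f => `[< exists g, g * f = 1 >].

Definition fps_inv f : fps A :=
  if pselect (exists g, g * f = 1) is left e then projT1 (cid e) else f.

Let mulV : {in fps_unit, left_inverse 1 fps_inv *%R}.
Proof.
move=> f /asboolP fU; rewrite /fps_inv; case: pselect => // e.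
exact: projT2 (cid e).
Qed.

Let unitP f g : g * f = 1 -> fps_unit f.
Proof. by move=> gf; apply/asboolP; exists g. Qed.

Let inv_out : {in [predC fps_unit], fps_inv =1 id}.
Proof.
move=> f /negP fU; rewrite /fps_inv; case: pselect => // e.
by case: fU; apply/asboolP.
Qed.

HB.instance Definition _ :=
  GRing.ComNzRing_hasMulInverse.Build (fps A) mulV unitP inv_out.

(* The t-adic sum of the f m; meaningful when t ^+ m divides f m for all m, so
   that the terms of index greater than n do not contribute to t ^+ n. *)
Definition fps_sum (f : nat -> fps A) : fps A :=
  Fps (fun n => \sum_(m < n.+1) f m n).

Lemma fps_sumE (f : nat -> fps A) n N :
    (forall m k, (k < m)%N -> f m k = 0) -> (n < N)%N ->
  (\sum_(m < N) f m) n = fps_sum f n.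
Proof.
move=> f0 nN.
have -> : (\sum_(m < N) f m) n = \sum_(m < N) f m n.
  by elim/big_rec2: _ => [|m y z _ <-] //=; rewrite if_same.
rewrite /= -(big_mkord xpredT (fun m => f m n)).
rewrite -(big_mkord xpredT (fun m => f m n)) (big_cat_nat (n := n.+1)) //=.
rewrite [X in _ + X]big_nat_cond [X in _ + X]big1 ?addr0 // => m.
by rewrite andbT => /andP[nm _]; apply: f0.
Qed.

Lemma fps_mulE f g n : (f * g) n = \sum_(k < n.+1) f k * g (n - k)%N.
Proof. by []. Qed.

Lemma fps_geoE l : (0 < l)%N ->
  (1 - fps_var ^+ l)^-1 = Fps (fun n => (l %| n)%:R) :> fps A.
Proof.
move=> l0.
have XnE k (f : fps A) n :
    (fps_var ^+ k * f) n = if (k <= n)%N then f (n - k)%N else 0.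
  elim: k n => [|k IHk] n; first by rewrite expr0 mul1r subn0.
  rewrite exprS -mulrA; move: (_ * f) IHk => h IHk.
  rewrite fps_mulE big_ord_recl /= mulr0n mul0r add0r.
  case: n => [|n]; first by rewrite big_ord0.
  rewrite big_ord_recl /= mulr1n mul1r subn1 IHk ltnS subSS.
  by rewrite big1 ?addr0 // => j _; rewrite mulr0n mul0r.
set g := Fps _.
have gE : (1 - fps_var ^+ l) * g = 1.
  rewrite mulrBl mul1r; apply: fpsP => n.
  transitivity (g n - (fps_var ^+ l * g) n); first by [].
  rewrite XnE /=; case: leqP => [ln|nl].
    rewrite dvdn_subl ?dvdnn // subrr; case: eqP => // n0.
    by rewrite n0 leqn0 in ln; rewrite (eqP ln) in l0.
  rewrite subr0; case: eqP => [->|/eqP n0]; first by rewrite dvdn0.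
  by rewrite gtnNdvd // lt0n.
have U : 1 - fps_var ^+ l \is a GRing.unit.
  by apply/unitrPr; exists g.
by apply: (mulrI U); rewrite mulrV.
Qed.

End FpsRing.

Arguments fps_var {A}.

Section Hypergeometric.
Variable K : numFieldType.

Definition pochhammer (a : K) (j : nat) : K := \prod_(k < j) (a + k%:R).

Lemma pochhammer_opp_nat m j : (m < j)%N -> pochhammer (- m%:R) j = 0.
Proof. by move=> mj; rewrite /pochhammer (bigD1 (Ordinal mj)) //= addNr mul0r. Qed.

Definition pFq_coef (a b : seq K) (j : nat) : K :=
  (\prod_(u <- a) pochhammer u j) / (\prod_(v <- b) pochhammer v j) / j`!%:R.

Definition pFq_terms (a b : seq K) (z : K) : nat -> K :=
  fun j => pFq_coef a b j * z ^+ j.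

Definition pFq (a b : seq K) (z : K) : K := limn (series (pFq_terms a b z)).

(* meaningful when z has no constant term, see fps_sumE *)
Definition pFq_fps (a b : seq K) (z : fps {poly K}) : fps {poly K} :=
  fps_sum (fun j => fps_const (pFq_coef a b j)%:P * z ^+ j).

(* pFq[-m, a; b; z]: by pochhammer_opp_nat the terms with j > m vanish. *)
Definition pFq_poly (m : nat) (a b : seq K) (z : {poly K}) : {poly K} :=
  \sum_(j < m.+1) pFq_coef (- m%:R :: a) b j *: z ^+ j.

End Hypergeometric.

Section Family.
Variables (K : numFieldType) (d l : nat) (alpha : 'I_d -> K) (i : 'I_l).

(* k : 'I_d.+1 stands for the 1-based index k + 1, and alpha_(d+1) = 0. *)
Definition alpha_ext (k : 'I_d.+1) : K :=
  if unlift ord_max k is Some k' then alpha k' else 0.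

Definition S_ (k : 'I_d.+1) (r : 'I_l) : K :=
  (alpha_ext k + i%:R - r%:R) / l%:R + 1.

Definition Shat : seq K :=
  [seq S_ p.1 p.2 | p <- enum {: 'I_d.+1 * 'I_l} & p != (ord_max, i)].

Lemma S_max : S_ ord_max i = 1.
Proof. by rewrite /S_ /alpha_ext unlift_none add0r subrr mul0r add0r. Qed.

Lemma size_Shat : size Shat = (l * d + l - 1)%N.
Proof.
have c : size (enum {: 'I_d.+1 * 'I_l}) = (d.+1 * l)%N.
  by rewrite -cardE card_prod !card_ord.
rewrite /Shat size_map size_filter; set s := enum _ in c *.
have := count_predC (pred1 (ord_max : 'I_d.+1, i)) s.
rewrite c count_uniq_mem ?enum_uniq // mem_enum inE /= mulSn mulnC addnC.
move=> sE; rewrite addnC in sE; rewrite -(addnC l) -sE addKn.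
exact: eq_count.
Qed.

Definition Q (m : nat) : {poly K} := 'X^i * pFq_poly m [::] Shat (- 'X^l).

Definition G (x t : K) : K :=
  (t * x) ^+ i / (1 - t ^+ l) * pFq [:: 1] Shat ((x * t) ^+ l / (1 - t ^+ l)).

(* G read as an element of K[x][[t]]; the constant term of 1 - t ^ l is 1, so
   it is invertible, see fps_geoE. *)
Definition G_fps : fps {poly K} :=
  let x := fps_const 'X in let t := fps_var in
  (t * x) ^+ i / (1 - t ^+ l)
    * pFq_fps [:: 1] Shat ((x * t) ^+ l / (1 - t ^+ l)).

End Family.

(* Main.v *)
Require Import Defs.
From HB Require Import structures.
From mathcomp Require Import all_boot all_order all_algebra.
From mathcomp Require Import all_classical all_reals all_analysis.
From mathcomp Require Import complex ring.
Set Implicit Arguments.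
Unset Strict Implicit.
Unset Printing Implicit Defensive.
Import Order.TTheory GRing.Theory Num.Theory.
Import numFieldNormedType.Exports.
Local Open Scope classical_set_scope.
Local Open Scope ring_scope.

(** The two hypergeometric series are built from the single sequence [c j], the inverse of the
    product of the [(v)_j] over the list of lower parameters [v]: the coefficients
    of the series with upper parameter [1] are the [c j], and those of the
    terminating series with upper parameter [-m] are [(-1)^j C(m,j) c j].  With
    [u = t^l] and [y = x^l], the polynomials are therefore, up to the factor
    [x^i], the binomial transforms [P_m = sum_j C(m,j) c_j y^j], and the theorem
    is the generating function of the binomial transform,
      [sum_m u^m P_m = sum_j c_j y^j u^j / (1 - u)^(j+1)],
    which follows by exchanging the sums from
      [sum_m C(m,j) u^m = u^j / (1 - u)^(j+1)].

    For formal power series the exchange is harmless, since every coefficient in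
    [t] is a finite sum; the last identity is Pascal's rule
    ([fps_binomialE]), and [G_fpsE] assembles the result.

    For complex [t] near [0], the partial sums up to [N] of the two sides differ,
    up to the factor [(t x)^i], by [sum_(j < N) c_j y^j R_(j,N)], where [R_(j,N)] is the remainder of order [N]
    of the binomial series above.  Pascal's rule becomes the recurrence
      [(1 - u) R_(j+1,N) = u R_(j,N) + C(N,j+1) u^N],
    from which induction on [j] gives
      [|R_(j,N)| r^j <= q^N / (1 - q)] with [q = |u| (1 + r)],
    for every [r >= 0] with [q < 1] ([binomial_tail_le]).  The [c_j] grow at most
    geometrically, because the factors [|v + k|^-1] of their inverse Pochhammer
    symbols are bounded in [k]; so [|c_j y^j| <= rho^j], and [r = 2 rho] makes the
    weighted sum of the remainders [O(q^N)]
    ([binomial_transform_error_le]).  The condition [q < 1] holds for [t] near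
    [0]; it also makes the hypergeometric series converge, being dominated by a
    geometric one. *)

(** * Coefficients of the two hypergeometric series *)

(** For sums weighted by [C(m,j)], which vanishes for [j > m], this replaces the
    bound [m] by one independent of [m], so that double sums can be exchanged. *)
Lemma sum_ord_extend (V : nmodType) (F : nat -> V) (m N : nat) :
    (m < N)%N -> (forall j, (m < j)%N -> F j = 0) ->
  \sum_(j < m.+1) F j = \sum_(j < N) F j.
Proof.
move=> mN F0; rewrite -!(big_mkord xpredT F).
rewrite [RHS](big_cat_nat (n := m.+1)) //= [X in _ = _ + X]big_nat_cond.
by rewrite [X in _ = _ + X]big1 ?addr0 // => j /andP[/andP[mj _] _]; apply: F0.
Qed.

Section PochhammerCoefficients.
Variable K : numFieldType.

Lemma pochhammer1E j : pochhammer (1 : K) j = j`!%:R.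
Proof.
elim: j => [|j IHj]; first by rewrite /pochhammer big_ord0.
by rewrite /pochhammer big_ord_recr /= -/(pochhammer _ _) IHj factS natrM
  mulrC nat1r.
Qed.

Lemma pochhammer_oppE m j :
  pochhammer (- m%:R : K) j = (-1) ^+ j * (m ^_ j)%:R.
Proof.
elim: j => [|j IHj]; first by rewrite /pochhammer big_ord0 mul1r.
rewrite /pochhammer big_ord_recr /= -/(pochhammer _ _) IHj ffactnSr natrM exprS.
case: (leqP j m) => [jm|mj]; first by rewrite natrB //; ring.
by rewrite ffact_small // !(mul0r, mulr0).
Qed.

Definition pochhammer_inv (b : seq K) (j : nat) : K :=
  (\prod_(v <- b) pochhammer v j)^-1.

Lemma pFq_coef1E b j : pFq_coef [:: 1] b j = pochhammer_inv b j.
Proof.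
by rewrite /pFq_coef big_seq1 pochhammer1E mulrAC mulfV ?mul1r ?pnatr_eq0 -?lt0n
  ?fact_gt0.
Qed.

Lemma pFq_coef_oppE m b j :
  pFq_coef [:: - m%:R] b j = (-1) ^+ j * 'C(m, j)%:R * pochhammer_inv b j.
Proof.
rewrite /pFq_coef big_seq1 pochhammer_oppE -bin_ffact natrM /pochhammer_inv.
have : j`!%:R != 0 :> K by rewrite pnatr_eq0 -lt0n fact_gt0.
by move: (_^-1) => p j0; field.
Qed.

Lemma pFq_poly_oppE m b (z : {poly K}) :
  pFq_poly m [::] b (- z) =
    \sum_(j < m.+1) ('C(m, j)%:R * pochhammer_inv b j) *: z ^+ j.
Proof.
apply: eq_bigr => j _; rewrite pFq_coef_oppE (exprNn z).
rewrite -[X in X * z ^+ j]signr_odd -[X in X * _ * _]signr_odd.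
case: (odd j); rewrite ?expr1 ?expr0 ?mul1r // !mulN1r mulNr.
by rewrite scaleNr scalerN opprK.
Qed.

End PochhammerCoefficients.

(** * The binomial generating function as a formal power series *)

Section FormalSeries.
Variable A : comNzRingType.
Implicit Types f g : fps A.

Lemma fps_subE f g n : (f - g) n = f n - g n. Proof. by []. Qed.

Lemma fps_varXME k f n :
  (fps_var ^+ k * f) n = if (k <= n)%N then f (n - k)%N else 0.
Proof.
elim: k n => [|k IHk] n; first by rewrite expr0 mul1r subn0.
rewrite exprS -mulrA; move: (_ * f) IHk => h IHk.
rewrite fps_mulE big_ord_recl /= mulr0n mul0r add0r.
case: n => [|n]; first by rewrite big_ord0.
rewrite big_ord_recl /= mulr1n mul1r subn1 IHk ltnS subSS.
by rewrite big1 ?addr0 // => j _; rewrite mulr0n mul0r.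
Qed.

Lemma fps_constME a f n : (fps_const a * f) n = a * f n.
Proof.
rewrite fps_mulE big_ord_recl /= subn0 big1 ?addr0 // => j _.
by rewrite mul0r.
Qed.

Lemma fps_constM a b : fps_const (a * b) = fps_const a * fps_const b :> fps A.
Proof.
by apply: fpsP => n; rewrite fps_constME /=; case: eqP; rewrite ?mulr0.
Qed.

Lemma fps_constX a k : fps_const (a ^+ k) = fps_const a ^+ k :> fps A.
Proof. by elim: k => [|k IHk] //; rewrite !exprS fps_constM IHk. Qed.

(** The series of [sum_m C(m,j) t^(l m)]; the exponent [n] is divided by [l] since
    the series is one in the variable [t^l]. *)
Definition fps_binomial l j : fps A :=
  Fps (fun n => if (l %| n)%N then 'C(n %/ l, j)%:R else 0).

(** Multiplying by [1 - t^l] takes differences of consecutive coefficients, which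
    Pascal's rule turns into a step from [j] to [j - 1] and a shift by [l]. *)
Lemma fps_binomialE l j : (0 < l)%N ->
  fps_var ^+ (l * j) / (1 - fps_var ^+ l) ^+ j.+1 = fps_binomial l j.
Proof.
move=> l0.
have B0 : (1 - fps_var ^+ l) * fps_binomial l 0 = 1.
  apply: fpsP => n; rewrite mulrBl mul1r fps_subE fps_varXME /=.
  case: (leqP l n) => [ln|nl].
    rewrite dvdn_subl // !bin0 subrr.
    by rewrite -[n == 0%N]negbK -lt0n (leq_trans l0 ln).
  rewrite subr0 bin0; case: (posnP n) => [->|n0]; first by rewrite dvdn0.
  by rewrite gtnNdvd // gtn_eqF.
have BS k : (1 - fps_var ^+ l) * fps_binomial l k.+1 =
    fps_var ^+ l * fps_binomial l k.
  apply: fpsP => n; rewrite mulrBl mul1r fps_subE !fps_varXME /=.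
  case: (leqP l n) => [ln|nl]; last first.
    by rewrite subr0 divn_small // bin0n if_same.
  rewrite dvdn_subl //; case: ifP => [/dvdnP[q nE]|_]; last by rewrite subrr.
  move: ln; rewrite nE => ln; case: q nE ln => [|q] nE ln.
    by rewrite mul0n leqn0 (gtn_eqF l0) in ln.
  by rewrite mulSn addKn -mulSn !mulnK // binS natrD addrAC subrr add0r.
have U : (1 - fps_var ^+ l : fps A) \is a GRing.unit.
  by apply/unitrPr; exists (fps_binomial l 0).
suff E : (1 - fps_var ^+ l) ^+ j.+1 * fps_binomial l j = fps_var ^+ (l * j).
  by rewrite -E mulrAC mulrV ?unitrX // mul1r.
elim: j => [|j IHj]; first by rewrite muln0 expr1 B0.
by rewrite exprSr -mulrA BS mulrCA IHj mulnS exprD.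
Qed.

(** The condition on [g] makes the sum converge [t]-adically, so that each
    coefficient sees only finitely many terms and ordinary distributivity applies. *)
Lemma fps_sum_mull f (g : nat -> fps A) :
    (forall m k, (k < m)%N -> g m k = 0) ->
  f * fps_sum g = fps_sum (fun m => f * g m).
Proof.
move=> g0; apply: fpsP => n.
have fg0 m k : (k < m)%N -> (f * g m) k = 0.
  move=> km; rewrite fps_mulE big1 // => j _.
  by rewrite g0 ?mulr0 // (leq_ltn_trans (leq_subr _ _)).
rewrite -(@fps_sumE _ _ n n.+1) // -mulr_sumr !fps_mulE.
apply: eq_bigr => j _; rewrite -(@fps_sumE _ _ _ n.+1) //.
by rewrite ltnS leq_subr.
Qed.

End FormalSeries.

(** * The identity of formal power series *)

Section FormalIdentity.
Variables (K : numFieldType) (d l : nat) (alpha : 'I_d -> K) (i : 'I_l).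

Let c := pochhammer_inv (Shat alpha i).

Lemma QE m : Q alpha i m =
  'X^i * \sum_(j < m.+1) ('C(m, j)%:R * c j) *: 'X^(l * j).
Proof.
by rewrite /Q pFq_poly_oppE; under eq_bigr do rewrite -exprM.
Qed.

Lemma Q_trunc m n : (m <= n)%N -> Q alpha i m =
  'X^i * \sum_(j < n.+1) ('C(m, j)%:R * c j) *: 'X^(l * j).
Proof.
move=> mn; rewrite QE; congr (_ * _).
rewrite (@sum_ord_extend _ (fun j => ('C(m, j)%:R * c j) *: 'X^(l * j)) m n.+1)
  // => j mj.
by rewrite bin_small // mul0r scale0r.
Qed.

Lemma G_fpsE (hl : (0 < l)%N) : G_fps alpha i =
  fps_sum (fun m => fps_var ^+ (m * l + i) * fps_const (Q alpha i m)).
Proof.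
rewrite /G_fps /pFq_fps; set x := fps_const 'X; set t := fps_var.
set w := 1 - t ^+ l.
have zE j : ((x * t) ^+ l / w) ^+ j = t ^+ (l * j) * (x ^+ (l * j) / w ^+ j).
  by rewrite exprMn exprVn -exprM exprMn -mulrA mulrCA.
rewrite fps_sum_mull => [|m k km]; last first.
  rewrite zE mulrCA fps_varXME leqNgt (leq_trans km) //.
  by rewrite -{1}[m]mul1n leq_mul2r hl orbT.
have termE j : (t * x) ^+ i / w *
    (fps_const (pFq_coef [:: 1] (Shat alpha i) j)%:P * ((x * t) ^+ l / w) ^+ j) =
    t ^+ i * (fps_const ('X^i * (c j *: 'X^(l * j))) * fps_binomial _ l j).
  rewrite zE pFq_coef1E -fps_binomialE // -mul_polyC !fps_constM !fps_constX.
  rewrite exprMn -[w ^+ j]/(w ^+ j) -!exprVn -/x -/t -/w exprS.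
  by move: (w^-1) => v; rewrite -/(c j); ring.
apply: fpsP => n.
(* Only [n = q l + i] contributes: on the left through [l %| n - i], where the sum
   over [j] rebuilds [Q q]; on the right through the single term [m = q]. *)
transitivity (\sum_(j < n.+1)
    (t ^+ i * (fps_const ('X^i * (c j *: 'X^(l * j))) * fps_binomial _ l j)) n).
  by apply: eq_bigr => j _; rewrite termE.
under eq_bigr do rewrite fps_varXME fps_constME /=.
transitivity (\sum_(m < n.+1) if n == (m * l + i)%N then Q alpha i m else 0).
  have [/andP[li /dvdnP[q nq]]|nli] := boolP ((i <= n)%N && (l %| n - i)%N).
    have nE : n = (q * l + i)%N by rewrite -nq subnK.
    have qn : (q < n.+1)%N.
      by rewrite ltnS nE (leq_trans (leq_pmulr q hl)) ?leq_addr.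
    rewrite [RHS](bigD1 (Ordinal qn)) //= -nE eqxx [X in _ + X]big1 ?addr0.
      rewrite li nq dvdn_mull // mulnK // (@Q_trunc q n) // mulr_sumr.
      apply: eq_bigr => j _; rewrite -!mul_polyC polyCM mulrC.
      by rewrite -[_%:R%:P]/(polyC _) polyC_natr; ring.
    move=> m /eqP mq; case: eqP => // nE'; case: mq; apply: val_inj => /=.
    move: (etrans (esym nE) nE') => /addIn /eqP.
    by rewrite eqn_pmul2r // => /eqP ->.
  rewrite !big1 // => m _.
    by case: eqP => // nE; rewrite nE leq_addl addnK dvdn_mull in nli.
  by move: nli; case: (i <= n)%N => //= /negPf ->; rewrite mulr0.
apply: eq_bigr => m _; rewrite fps_varXME /=.
case: ltngtP => // [nm|nm]; last by rewrite nm subnn.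
by rewrite subn_eq0 leqNgt nm.
Qed.
End FormalIdentity.

(** * Remainders of the binomial generating function *)

Section BinomialTail.
Variable K : numFieldType.
Implicit Types (u r y : K) (c : nat -> K).

Definition binomial_tail u (j N : nat) : K :=
  u ^+ j / (1 - u) ^+ j.+1 - \sum_(m < N) 'C(m, j)%:R * u ^+ m.

Lemma binomial_tail0 u N : u != 1 ->
  (1 - u) * binomial_tail u 0 N = u ^+ N.
Proof.
move=> u1; have u0 : 1 - u != 0 by rewrite subr_eq0 eq_sym.
rewrite /binomial_tail mulrBr expr0 expr1 mul1r mulfV //.
elim: N => [|N IHN]; first by rewrite big_ord0 mulr0 subr0.
by rewrite big_ord_recr /= bin0 mul1r mulrDr opprD addrA IHN exprS; ring.
Qed.

Lemma binomial_tailS u j N : u != 1 ->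
  (1 - u) * binomial_tail u j.+1 N =
    u * binomial_tail u j N + 'C(N, j.+1)%:R * u ^+ N.
Proof.
move=> u1; have u0 : 1 - u != 0 by rewrite subr_eq0 eq_sym.
have sumE : (1 - u) * (\sum_(m < N) 'C(m, j.+1)%:R * u ^+ m) =
    u * (\sum_(m < N) 'C(m, j)%:R * u ^+ m) - 'C(N, j.+1)%:R * u ^+ N.
  elim: N => [|N IHN]; first by rewrite !big_ord0 bin0n !mulr0 mul0r subr0.
  by rewrite !big_ord_recr /= mulrDr IHN binS natrD exprS; ring.
rewrite /binomial_tail !mulrBr sumE [_ ^+ j.+2]exprS [_ ^+ j.+1 in LHS]exprS.
by rewrite invfM; move: (_ ^+ j.+1)^-1 => v; field.
Qed.

Lemma bin_expr_le r j N : 0 <= r -> 'C(N, j)%:R * r ^+ j <= (1 + r) ^+ N.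
Proof.
move=> r0; case: (leqP j N) => [jN|Nj]; last first.
  by rewrite bin_small // mul0r exprn_ge0 // addr_ge0.
rewrite exprDn (bigD1 (Ordinal (jN : (j < N.+1)%N))) //= expr1n mul1r.
rewrite mulr_natl lerDl sumr_ge0 // => k _.
by rewrite mulrn_wge0 // expr1n mul1r exprn_ge0.
Qed.

(** The weight [r^j] absorbs the growth of [C(N,j)] into [(1 + r)^N], which makes
    the bound uniform in [j].  Induction on [j] closes because
    [|u| r + (1 - q) = 1 - |u| <= |1 - u|]. *)
Lemma binomial_tail_le u r j N : 0 <= r -> `|u| * (1 + r) < 1 ->
  `|binomial_tail u j N| * r ^+ j
    <= (`|u| * (1 + r)) ^+ N / (1 - `|u| * (1 + r)).
Proof.
move=> r0; set q := _ * _ => q1.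
have uq : `|u| <= q by rewrite ler_peMr // lerDl.
have u1 : `|u| < 1 by apply: le_lt_trans q1.
have u1' : u != 1 by apply: contraTneq u1 => ->; rewrite normr1 ltxx.
have a0 : 0 < 1 - `|u| by rewrite subr_gt0.
have q0 : 0 < 1 - q by rewrite subr_gt0.
have aq : 1 - `|u| <= `|1 - u|.
  by rewrite -[X in X - _](normr1 K) lerB_dist.
have qN0 : 0 <= q ^+ N by rewrite exprn_ge0 // mulr_ge0 // addr_ge0.
rewrite -(ler_pM2l a0).
suff H : `|(1 - u) * binomial_tail u j N| * r ^+ j
    <= (1 - `|u|) * (q ^+ N / (1 - q)).
  apply: le_trans H; rewrite normrM -mulrA ler_wpM2r //.
  by rewrite mulr_ge0 // exprn_ge0.
have binq k : `|('C(N, k)%:R : K) * u ^+ N| * r ^+ k <= q ^+ N.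
  rewrite normrM normrX normr_nat mulrAC exprMn mulrC.
  by rewrite ler_wpM2l ?exprn_ge0 // bin_expr_le.
elim: j => [|j IHj].
  have := binq 0; rewrite bin0 mul1r binomial_tail0 // => /le_trans -> //.
  by rewrite mulrCA ler_peMr // ler_pdivlMr // mul1r lerB.
have {}IHj : `|binomial_tail u j N| * r ^+ j <= q ^+ N / (1 - q).
  rewrite -(ler_pM2l a0); apply: le_trans IHj.
  by rewrite normrM -mulrA ler_wpM2r // mulr_ge0 // exprn_ge0.
rewrite binomial_tailS //.
have -> : (1 - `|u|) * (q ^+ N / (1 - q)) =
    `|u| * r * (q ^+ N / (1 - q)) + q ^+ N.
  by move: q0; rewrite /q => /gt_eqF/negbT ?; field.
apply: le_trans (_ : (`|u * binomial_tail u j N| +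
  `|('C(N, j.+1)%:R : K) * u ^+ N|) * r ^+ j.+1 <= _).
  by rewrite ler_wpM2r ?exprn_ge0 // ler_normD.
rewrite mulrDl lerD // normrM exprS.
rewrite [leLHS](_ : _ = `|u| * r * (`|binomial_tail u j N| * r ^+ j)).
  by rewrite ler_wpM2l // mulr_ge0.
by ring.
Qed.

Lemma sum_half_le N : \sum_(j < N) (2^-1 : K) ^+ j <= 2.
Proof.
rewrite (_ : \sum_(j < N) _ = 2 - 2 * 2^-1 ^+ N).
  by rewrite gerBl mulr_ge0 // exprn_ge0 // invr_ge0.
elim: N => [|N IHN]; first by rewrite big_ord0; ring.
by rewrite big_ord_recr /= IHN exprS; field.
Qed.

Definition binomial_transform c y m :=
  \sum_(j < m.+1) 'C(m, j)%:R * c j * y ^+ j.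

Lemma binomial_transform_seriesE c y u N :
  \sum_(m < N) u ^+ m * binomial_transform c y m =
    \sum_(j < N) c j * y ^+ j * (u ^+ j / (1 - u) ^+ j.+1)
    - \sum_(j < N) c j * y ^+ j * binomial_tail u j N.
Proof.
have truncE m : (m < N)%N -> binomial_transform c y m =
    \sum_(j < N) 'C(m, j)%:R * c j * y ^+ j.
  move=> mN.
  apply: (@sum_ord_extend _ (fun j => 'C(m, j)%:R * c j * y ^+ j)) => // j mj.
  by rewrite bin_small // !mul0r.
under eq_bigr do rewrite truncE // mulr_sumr.
rewrite exchange_big -sumrB; apply: eq_bigr => j _.
rewrite /binomial_tail -mulrBr subKr mulr_sumr; apply: eq_bigr => m _.
by ring.
Qed.

(** With [r = 2 rho] in [binomial_tail_le], the [j]-th term of the sum is at most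
    [2^-j q^N / (1 - q)]. *)
Lemma binomial_transform_error_le c y u rho N :
    0 < rho -> (forall j, `|c j * y ^+ j| <= rho ^+ j) ->
    `|u| * (1 + 2 * rho) < 1 ->
  `|\sum_(j < N) c j * y ^+ j * binomial_tail u j N|
    <= 2 / (1 - `|u| * (1 + 2 * rho)) * (`|u| * (1 + 2 * rho)) ^+ N.
Proof.
move=> rho0 cy q1; have r0 : 0 < 2 * rho by rewrite mulr_gt0.
apply: le_trans (ler_norm_sum _ _ _) _.
set B := (_ * _) ^+ N; set p := 1 - _.
apply: le_trans (_ : \sum_(j < N) 2^-1 ^+ j * (B / p) <= _).
  apply: ler_sum => j _; rewrite normrM.
  apply: le_trans (_ : rho ^+ j * `|binomial_tail u j N| <= _).
    by rewrite ler_wpM2r.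
  rewrite (_ : rho ^+ j = 2^-1 ^+ j * (2 * rho) ^+ j).
    rewrite -mulrA ler_wpM2l ?exprn_ge0 ?invr_ge0 // mulrC.
    by apply: binomial_tail_le => //; apply: ltW.
  by rewrite -exprMn mulrA mulVf ?mul1r // pnatr_eq0.
rewrite -mulr_suml mulrAC -mulrA ler_wpM2r ?sum_half_le // mulr_ge0 //.
  by rewrite exprn_ge0 // mulr_ge0 // addr_ge0 // ltW.
by rewrite invr_ge0 subr_ge0 ltW.
Qed.

End BinomialTail.

(** * Geometric domination of complex sequences *)

Section ComplexAnalysis.
Variable R : realType.
Local Notation C := (Cplx R).
Local Notation "x %:C" := (real_complex R x : C).
Local Notation ReC := (@complex.Re R).
Local Notation ImC := (@complex.Im R).

Lemma cplx_ge0P (z : C) : 0 <= z -> exists2 x : R, 0 <= x & z = x%:C.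
Proof.
case: z => a b; rewrite lecE /= => /andP[/eqP -> a0].
by exists a.
Qed.

Lemma cplx_cvg_realP (f : nat -> C) (g : nat -> R) (l : C) :
  (forall n, `|l - f n| <= (g n)%:C) -> g @ \oo --> (0 : R) -> f @ \oo --> l.
Proof.
move=> fg g0; apply/cvgrPdist_lt => e e0.
have [x x0 ex] := cplx_ge0P (ltW e0).
have {}x0 : 0 < x by rewrite -ltcR -ex.
move/cvgrPdist_lt: g0 => /(_ x x0); apply: filterS => n gx.
apply: le_lt_trans (fg n) _; rewrite ex ltcR.
by apply: le_lt_trans gx; rewrite sub0r normrN ler_norm.
Qed.

Lemma cplx_cvg0_geometric (f : nat -> C) (a q : C) : 0 <= q -> q < 1 ->
  0 <= a -> (forall n, `|f n| <= a * q ^+ n) -> f @ \oo --> (0 : C).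
Proof.
move=> /cplx_ge0P[p p0 ->] p1 /cplx_ge0P[b b0 ->] fq.
have {}p1 : p < 1 by rewrite -ltcR.
apply: (@cplx_cvg_realP _ (geometric b p)).
  by move=> n; rewrite sub0r normrN (le_trans (fq n)) // /= rmorphM rmorphXn.
by apply: cvg_geometric; rewrite ger0_norm.
Qed.

Lemma Re_sum (f : nat -> C) n :
  ReC (\sum_(k < n) f k) = \sum_(k < n) ReC (f k).
Proof.
elim: n => [|n IHn]; first by rewrite !big_ord0.
by rewrite !big_ord_recr /= -IHn; case: (\sum_(k < n) f k) (f n) => ? ? [].
Qed.

Lemma Im_sum (f : nat -> C) n :
  ImC (\sum_(k < n) f k) = \sum_(k < n) ImC (f k).
Proof.
elim: n => [|n IHn]; first by rewrite !big_ord0.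
by rewrite !big_ord_recr /= -IHn; case: (\sum_(k < n) f k) (f n) => ? ? [].
Qed.

(** The real and imaginary parts are series of reals dominated by the same
    geometric series, so completeness is only used over the reals. *)
Lemma cplx_series_cvg_geometric (f : nat -> C) (q : C) : 0 <= q -> q < 1 ->
  (forall n, `|f n| <= q ^+ n) -> cvgn (series f).
Proof.
move=> /cplx_ge0P[p p0 ->] p1 fq.
have {}p1 : p < 1 by rewrite -ltcR.
have real_cvg (g : nat -> R) : (forall n, `|g n|%:C <= `|f n|) ->
    cvgn (series g).
  move=> gf; apply: normed_cvg; apply: (@series_le_cvg _ _ (geometric 1 p)).
  - by move=> n; apply: normr_ge0.
  - by move=> n; apply: geometric_ge0.
  - move=> n /=; rewrite mul1r -lecR rmorphXn.
    exact: le_trans (gf n) (fq n).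
  by apply: is_cvg_geometric_series; rewrite ger0_norm.
pose g n : R := ReC (f n); pose h n : R := ImC (f n).
have reC : cvgn (series g).
  apply: real_cvg => n; rewrite normc_def lecR -sqrtr_sqr ler_wsqrtr //.
  by rewrite lerDl sqr_ge0.
have imC : cvgn (series h).
  apply: real_cvg => n; rewrite normc_def lecR -sqrtr_sqr ler_wsqrtr //.
  by rewrite lerDr sqr_ge0.
pose a : R := limn (series g); pose b : R := limn (series h).
have fa : series g @ \oo --> a by exact: reC.
have fb : series h @ \oo --> b by exact: imC.
pose z : C := Complex a b.
suff fz : series f @ \oo --> z by exact: cvgP fz.
apply: (@cplx_cvg_realP _ (fun n => `|a - series g n| + `|b - series h n|)).
  move=> n; rewrite [X in `|X|](_ : _ = ((a - series g n)%:C +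
    'i%C * (b - series h n)%:C)).
    apply: le_trans (ler_normD _ _) _.
    rewrite normrM !normc_def /= expr0n expr1n /= add0r !addr0 sqrtr1.
    by rewrite mul1r !sqrtr_sqr rmorphD.
  rewrite /series /= !big_mkord -Re_sum -Im_sum [LHS]complexE.
  by case: (\sum_(k < n) f k) => u v.
rewrite -[0 : R]addr0; apply: cvgD; apply/norm_cvg0P.
  by rewrite -(subrr a); apply: cvgB => //; apply: cvg_cst.
by rewrite -(subrr b); apply: cvgB => //; apply: cvg_cst.
Qed.

(** For [k >= |s| + 1] the inverse is at most [1]; adding to [1] the finitely many
    earlier inverses bounds them all. *)
Lemma shift_norm_inv_bounded (s : C) :
  exists2 M : C, 0 <= M & forall k : nat, `|s + k%:R|^-1 <= M.
Proof.
have [x x0 sx] := cplx_ge0P (normr_ge0 s).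
pose n := Num.bound x.
have sn : `|s| <= n%:R.
  have -> : n%:R = (n%:R : R)%:C by rewrite rmorph_nat.
  by rewrite sx lecR ltW // archi_boundP.
exists (1 + \sum_(k < n.+1) `|s + k%:R|^-1).
  by rewrite addr_ge0 // sumr_ge0 // => k _; rewrite invr_ge0.
move=> k; have [kn|nk] := ltnP k n.+1.
  by rewrite (bigD1 (Ordinal kn)) //= addrCA lerDl addr_ge0 // sumr_ge0.
apply: le_trans (_ : 1 <= _); last first.
  by rewrite lerDl sumr_ge0 // => j _; rewrite invr_ge0.
have sk : 1 <= `|s + k%:R|.
  rewrite addrC -[s]opprK; apply: le_trans (lerB_dist _ _).
  rewrite normr_nat normrN lerBrDl (le_trans (_ : _ <= n%:R + 1)) ?lerD2r //.
  by rewrite natr1 ler_nat.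
by rewrite invf_le1 // (lt_le_trans _ sk).
Qed.

Lemma pochhammer_inv_bounded (b : seq C) :
  exists2 M : C, 0 <= M & forall j, `|pochhammer_inv b j| <= M ^+ j.
Proof.
elim: b => [|s b [M M0 bM]].
  by exists 1 => // j; rewrite /pochhammer_inv big_nil invr1 normr1 expr1n.
have [D D0 sD] := shift_norm_inv_bounded s.
exists (D * M); first exact: mulr_ge0.
move=> j; rewrite /pochhammer_inv big_cons invfM normrM exprMn.
apply: ler_pM (bM j); rewrite ?normr_ge0 // normfV /pochhammer.
elim: j => [|j IHj]; first by rewrite big_ord0 normr1 invr1.
by rewrite big_ord_recr /= normrM invfM exprSr ler_pM ?invr_ge0.
Qed.

Lemma near0_norm_lt (e : C) : 0 < e -> \forall t \near (0 : C), `|t| < e.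
Proof. by move=> e0; apply/nbhs_norm0P; exists e. Qed.

End ComplexAnalysis.

(** * The identity of convergent series *)

Section AnalyticIdentity.
Variables (R : realType) (d l : nat) (hl : (0 < l)%N).
Local Notation C := (Cplx R).
Variables (alpha : 'I_d -> C) (i : 'I_l).

Let c := pochhammer_inv (Shat alpha i).

Lemma horner_Q m (x : C) :
  (Q alpha i m).[x] = x ^+ i * binomial_transform c (x ^+ l) m.
Proof.
rewrite QE hornerM hornerXn horner_sum; congr (_ * _).
by apply: eq_bigr => j _; rewrite hornerZ hornerXn exprM.
Qed.

Lemma G_cvg (x : C) : \forall t \near (0 : C),
  cvgn (series (pFq_terms [:: 1] (Shat alpha i) ((x * t) ^+ l / (1 - t ^+ l))))
  /\ series (fun m => t ^+ (m * l + i) * (Q alpha i m).[x]) @ \oo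
       --> G alpha i x t.
Proof.
have [M M0 cM] := pochhammer_inv_bounded (Shat alpha i).
(* The added [1] keeps [rho] positive even if [M * `|y|] vanishes. *)
set y := x ^+ l; pose rho := M * `|y| + 1.
have rho0 : 0 < rho by rewrite ltr_wpDl // mulr_ge0.
have cy j : `|c j * y ^+ j| <= rho ^+ j.
  rewrite normrM normrX; apply: le_trans (_ : (M * `|y|) ^+ j <= _).
    by rewrite exprMn ler_wpM2r ?exprn_ge0.
  by rewrite lerXn2r ?nnegrE ?(ltW rho0) ?mulr_ge0 // lerDl.
have r0 : 0 < 1 + 2 * rho by rewrite addr_gt0 // mulr_gt0.
have r1 : 1 <= 1 + 2 * rho by rewrite lerDl mulr_ge0 // ltW.
have : \forall t \near (0 : C), `|t| < (1 + 2 * rho)^-1.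
  by apply: near0_norm_lt; rewrite invr_gt0.
apply: filterS => t tr; set u := t ^+ l.
have t1 : `|t| <= 1 by rewrite (le_trans (ltW tr)) // invf_le1.
have q1 : `|u| * (1 + 2 * rho) < 1.
  rewrite -ltr_pdivlMr // mul1r; apply: le_lt_trans tr.
  by rewrite normrX -{2}[`|t|]expr1 ler_wiXn2l.
have u1 : `|u| < 1 by apply: le_lt_trans q1; rewrite ler_peMr.
have v0 : 0 < 1 - `|u| by rewrite subr_gt0.
have vu : 1 - `|u| <= `|1 - u|.
  by rewrite -[X in X - _](normr1 C) lerB_dist.
have v0' : 0 < `|1 - u| by apply: lt_le_trans vu.
have termE j : pFq_terms [:: 1] (Shat alpha i) ((x * t) ^+ l / (1 - u)) j =
    c j * y ^+ j * (u ^+ j / (1 - u) ^+ j).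
  rewrite /pFq_terms pFq_coef1E -/(c j) expr_div_n [(x * t) ^+ l]exprMn.
  by rewrite -/u -/y exprMn !mulrA.
have cT : cvgn (series (pFq_terms [:: 1] (Shat alpha i)
    ((x * t) ^+ l / (1 - u)))).
  apply: (@cplx_series_cvg_geometric _ _ (rho * (`|u| / `|1 - u|))).
  - by rewrite mulr_ge0 ?(ltW rho0) // divr_ge0.
  (* [rho |u| < |1 - u|], since [|u| + rho |u| <= |u| (1 + 2 rho) < 1]. *)
  - rewrite mulrA ltr_pdivrMr // mul1r; apply: lt_le_trans vu.
    rewrite ltrBrDl; apply: le_lt_trans q1.
    by rewrite mulrDr mulr1 lerD2l mulrC ler_wpM2l // ler_peMl
      ?(ltW rho0) ?ler1n.
  move=> n; rewrite termE normrM exprMn ler_pM // expr_div_n.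
  by rewrite normrM normfV !normrX.
split; first exact: cT.
rewrite /G -/u /pFq.
have -> : series (fun m => t ^+ (m * l + i) * (Q alpha i m).[x]) =
  (fun N => (t * x) ^+ i * (1 - u)^-1 *
    series (pFq_terms [:: 1] (Shat alpha i) ((x * t) ^+ l / (1 - u))) N
   - (t * x) ^+ i * \sum_(j < N) c j * y ^+ j * binomial_tail u j N).
  apply/funext => N; rewrite -mulrA -mulrBr /series /= !big_mkord.
  transitivity ((t * x) ^+ i * \sum_(m < N) u ^+ m * binomial_transform c y m).
    rewrite mulr_sumr; apply: eq_bigr => m _.
    by rewrite horner_Q exprD mulnC exprM exprMn -/u -/y; ring.
  rewrite binomial_transform_seriesE mulr_sumr; congr (_ * (_ - _)).
  apply: eq_bigr => j _; rewrite termE exprS invfM.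
  by move: (_ ^-1) (_ ^-1) => a b; ring.
rewrite -[X in _ --> X]subr0 -[X in _ --> _ - X](mulr0 ((t * x) ^+ i)).
apply: cvgB; first exact: cvgMl_tmp.
apply: cvgMl_tmp.
apply: cplx_cvg0_geometric (fun N => @binomial_transform_error_le _ c y u rho N
  rho0 cy q1) => //.
  by rewrite mulr_ge0 // ltW.
by rewrite divr_ge0 // subr_ge0 ltW.
Qed.
End AnalyticIdentity.

Theorem theorem4p7 (R : realType) (d l : nat) (hl : (1 <= l)%N)
    (alpha : 'I_d -> Cplx R) (i : 'I_l)
    (hS : forall s, s \in Shat alpha i -> forall n : nat, s <> - n%:R) :
  G_fps alpha i
    = fps_sum (fun m => fps_var ^+ (m * l + i) * fps_const (Q alpha i m))
  /\ (forall x : Cplx R, \forall t \near (0 : Cplx R),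
        cvgn (series (pFq_terms [:: 1] (Shat alpha i)
                        ((x * t) ^+ l / (1 - t ^+ l))))
        /\ series (fun m => t ^+ (m * l + i) * (Q alpha i m).[x]) @ \oo
             --> G alpha i x t).
Proof. by split=> [|x]; [apply: G_fpsE | apply: G_cvg]. Qed.
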